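(* Over a field of characteristic not $2$, the di-Malcev identity $$((xy)z)t - ((xt)y)z - (x(zt))y - (xz)(yt) - x((yz)t) \equiv 0$$ is not equivalent, in the free right anticommutative algebra, to the identity $$L(y,x,zx) \equiv L(y,z,x)x, \qquad\text{where } L(x,y,z) = (xy)z - x(yz) - (xz)y.$$
   Context: A right anticommutative algebra is a vector space with a bilinear operation $xy$ satisfying $x(yz)+x(zy)\equiv 0$. Equivalence of identities of degree $4$ is understood as follows. Consider the multilinear subspace of degree $4$ of the free right anticommutative algebra on four generators, as a module over the symmetric group $S_4$ acting by permutations of the variables. An identity $f$ of degree $n$ is a consequence of identities $f_1,\dots,f_k$ of degree $n$ if $f$ belongs to the $S_n$-submodule generated by $f_1,\dots,f_k$; two identities are equivalent if each is a consequence of the other. The identity $L(y,x,zx)\equiv L(y,z,x)x$, which is quadratic in $x$, is represented in this multilinear space by its linearization $L(y,x,zw)+L(y,w,zx)-L(y,z,x)w-L(y,z,w)x\equiv 0$. *)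

(* Defs.v *)
From HB Require Import structures.
From mathcomp Require Import all_boot all_order all_algebra perm.
From mathcomp Require Import boolp classical_sets.

Set Implicit Arguments.
Unset Strict Implicit.
Unset Printing Implicit Defensive.

Import GRing.Theory.
Local Open Scope ring_scope.
Local Open Scope quotient_scope.

HB.mixin Record isRightAnticommutative (F : fieldType) V
    of GRing.Lmodule F V := {
  ramul : V -> V -> V;
  ramul_linearl : forall y, linear (ramul^~ y);
  ramul_linearr : forall x, linear (ramul x);
  ramul_rac : forall x y z, ramul x (ramul y z) + ramul x (ramul z y) = 0
}.

#[short(type="raAlgType")]
HB.structure Definition RAAlgebra (F : fieldType) :=
  { V of GRing.Lmodule F V & isRightAnticommutative F V }.

Notation "x ** y" := (ramul x y) (at level 40, left associativity) : ring_scope.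

(* The free algebra is built as terms modulo the least congruence containing
   the axioms of vector spaces, bilinearity, and right anticommutativity; its
   universal property is [ralift_gen], [ralift_linear], [ralift_mul] and
   [ralift_unique]. *)

Inductive raterm (F X : Type) : Type :=
| RAgen of X
| RAzero
| RAadd of raterm F X & raterm F X
| RAopp of raterm F X
| RAscale of F & raterm F X
| RAmul of raterm F X & raterm F X.

Arguments RAgen {F X} _.
Arguments RAzero {F X}.

HB.instance Definition _ (F X : Type) := gen_eqMixin (raterm F X).
HB.instance Definition _ (F X : Type) := gen_choiceMixin (raterm F X).

Inductive racong (F : fieldType) (X : Type) :
    raterm F X -> raterm F X -> Prop :=
| rc_refl u : racong u u
| rc_sym u v : racong u v -> racong v u
| rc_trans u v w : racong u v -> racong v w -> racong u w
| rc_add u u' v v' :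
    racong u u' -> racong v v' -> racong (RAadd u v) (RAadd u' v')
| rc_opp u u' : racong u u' -> racong (RAopp u) (RAopp u')
| rc_scale a u u' : racong u u' -> racong (RAscale a u) (RAscale a u')
| rc_mul u u' v v' :
    racong u u' -> racong v v' -> racong (RAmul u v) (RAmul u' v')
| rc_addA u v w : racong (RAadd u (RAadd v w)) (RAadd (RAadd u v) w)
| rc_addC u v : racong (RAadd u v) (RAadd v u)
| rc_add0 u : racong (RAadd RAzero u) u
| rc_addN u : racong (RAadd (RAopp u) u) RAzero
| rc_scaleA a b u : racong (RAscale a (RAscale b u)) (RAscale (a * b) u)
| rc_scale1 u : racong (RAscale 1 u) u
| rc_scaleDr a u v :
    racong (RAscale a (RAadd u v)) (RAadd (RAscale a u) (RAscale a v))
| rc_scaleDl a b u :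
    racong (RAscale (a + b) u) (RAadd (RAscale a u) (RAscale b u))
| rc_mul_linearl a u v w :
    racong (RAmul (RAadd (RAscale a u) v) w)
           (RAadd (RAscale a (RAmul u w)) (RAmul v w))
| rc_mul_linearr a u v w :
    racong (RAmul w (RAadd (RAscale a u) v))
           (RAadd (RAscale a (RAmul w u)) (RAmul w v))
| rc_rac u v w :
    racong (RAadd (RAmul u (RAmul v w)) (RAmul u (RAmul w v))) RAzero.

Section FreeAlgebra.
Variables (F : fieldType) (X : Type).

Definition racongb (u v : raterm F X) : bool := `[< racong u v >].

Lemma racongb_refl : reflexive racongb.
Proof. by move=> u; apply/asboolP; exact: rc_refl. Qed.

Lemma racongb_sym : symmetric racongb.
Proof. by move=> u v; apply/asboolP/asboolP; exact: rc_sym. Qed.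

Lemma racongb_trans : transitive racongb.
Proof.
by move=> v u w /asboolP uv /asboolP vw; apply/asboolP; exact: rc_trans uv vw.
Qed.

Canonical racong_equiv := EquivRel racongb racongb_refl racongb_sym
  racongb_trans.

Definition freeRA : Type := {eq_quot racong_equiv}.

HB.instance Definition _ := Choice.on freeRA.
HB.instance Definition _ := EqQuotient.on freeRA.

Definition racls (u : raterm F X) : freeRA := \pi_freeRA u.

Lemma raclsP u v : racls u = racls v <-> racong u v.
Proof.
split=> [/eqmodP/asboolP //|uv].
by apply/eqmodP; apply/asboolP.
Qed.

Lemma raclsK (x : freeRA) : racls (repr x) = x.
Proof. exact: reprK. Qed.

Lemma repr_racls u : racong (repr (racls u)) u.
Proof. by apply/raclsP; rewrite raclsK. Qed.

Definition ragen (i : X) : freeRA := racls (RAgen i).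
Definition free_zero : freeRA := racls RAzero.
Definition free_add (x y : freeRA) := racls (RAadd (repr x) (repr y)).
Definition free_opp (x : freeRA) := racls (RAopp (repr x)).
Definition free_scale (a : F) (x : freeRA) := racls (RAscale a (repr x)).
Definition free_mul (x y : freeRA) := racls (RAmul (repr x) (repr y)).

Lemma free_addE u v : free_add (racls u) (racls v) = racls (RAadd u v).
Proof. by apply/raclsP; apply: rc_add; exact: repr_racls. Qed.

Lemma free_oppE u : free_opp (racls u) = racls (RAopp u).
Proof. by apply/raclsP; apply: rc_opp; exact: repr_racls. Qed.

Lemma free_scaleE a u : free_scale a (racls u) = racls (RAscale a u).
Proof. by apply/raclsP; apply: rc_scale; exact: repr_racls. Qed.

Lemma free_mulE u v : free_mul (racls u) (racls v) = racls (RAmul u v).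
Proof. by apply/raclsP; apply: rc_mul; exact: repr_racls. Qed.

Let freeE := (free_addE, free_oppE, free_scaleE, free_mulE).

Fact free_addA : associative free_add.
Proof.
move=> x y z; rewrite -(raclsK x) -(raclsK y) -(raclsK z) !freeE.
by apply/raclsP; exact: rc_addA.
Qed.

Fact free_addC : commutative free_add.
Proof.
by move=> x y; rewrite -(raclsK x) -(raclsK y) !freeE; apply/raclsP; exact: rc_addC.
Qed.

Fact free_add0 : left_id free_zero free_add.
Proof.
by move=> x; rewrite -(raclsK x) /free_zero !freeE; apply/raclsP; exact: rc_add0.
Qed.

Fact free_addN : left_inverse free_zero free_opp free_add.
Proof. by move=> x; rewrite -(raclsK x) !freeE; apply/raclsP; exact: rc_addN. Qed.

HB.instance Definition _ :=
  GRing.isZmodule.Build freeRA free_addA free_addC free_add0 free_addN.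

Fact free_scaleA a b x : free_scale a (free_scale b x) = free_scale (a * b) x.
Proof. by rewrite -(raclsK x) !freeE; apply/raclsP; exact: rc_scaleA. Qed.

Fact free_scale1 : left_id 1 free_scale.
Proof. by move=> x; rewrite -(raclsK x) !freeE; apply/raclsP; exact: rc_scale1. Qed.

Fact free_scaleDr : right_distributive free_scale +%R.
Proof.
move=> a x y; rewrite -(raclsK x) -(raclsK y) /GRing.add /= !freeE.
by apply/raclsP; exact: rc_scaleDr.
Qed.

Fact free_scaleDl x : {morph free_scale^~ x : a b / a + b}.
Proof.
move=> a b; rewrite -(raclsK x) [RHS]/GRing.add /= !freeE.
by apply/raclsP; exact: rc_scaleDl.
Qed.

HB.instance Definition _ := GRing.Zmodule_isLmodule.Build F freeRA
  free_scaleA free_scale1 free_scaleDr free_scaleDl.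

Lemma raclsD u v : racls (RAadd u v) = racls u + racls v.
Proof. by rewrite -free_addE. Qed.

Lemma raclsZ a u : racls (RAscale a u) = a *: racls u.
Proof. by rewrite -free_scaleE. Qed.

Fact free_mul_linearl y : linear (free_mul^~ y).
Proof.
move=> a u v; rewrite -(raclsK u) -(raclsK v) -(raclsK y).
rewrite -raclsZ -raclsD !freeE -raclsZ -raclsD.
by apply/raclsP; exact: rc_mul_linearl.
Qed.

Fact free_mul_linearr x : linear (free_mul x).
Proof.
move=> a u v; rewrite -(raclsK u) -(raclsK v) -(raclsK x).
rewrite -raclsZ -raclsD !freeE -raclsZ -raclsD.
by apply/raclsP; exact: rc_mul_linearr.
Qed.

Fact free_mul_rac x y z :
  free_mul x (free_mul y z) + free_mul x (free_mul z y) = 0.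
Proof.
rewrite -(raclsK x) -(raclsK y) -(raclsK z) !freeE -raclsD.
by apply/raclsP; exact: rc_rac.
Qed.

HB.instance Definition _ := isRightAnticommutative.Build F freeRA
  free_mul_linearl free_mul_linearr free_mul_rac.

Lemma raclsN u : racls (RAopp u) = - racls u.
Proof. by rewrite -free_oppE. Qed.

Lemma raclsM u v : racls (RAmul u v) = racls u ** racls v.
Proof. by rewrite -free_mulE. Qed.

Lemma freeRA_ind (P : freeRA -> Prop) :
  (forall i, P (ragen i)) -> P 0 ->
  (forall a x y, P x -> P y -> P (a *: x + y)) ->
  (forall x y, P x -> P y -> P (x ** y)) -> forall x, P x.
Proof.
move=> Pg P0 PL PM x; rewrite -(raclsK x); elim: (repr x) => //=.
- by move=> u Pu v Pv; rewrite raclsD -(scale1r (racls u)); exact: PL.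
- by move=> u Pu; rewrite raclsN -scaleN1r -[_ *: _]addr0; exact: PL.
- by move=> a u Pu; rewrite raclsZ -[_ *: _]addr0; exact: PL.
- by move=> u Pu v Pv; rewrite raclsM; exact: PM.
Qed.

Section Lift.
Variables (A : raAlgType F) (h : X -> A).

Fixpoint raeval (u : raterm F X) : A :=
  match u with
  | RAgen i => h i
  | RAzero => 0
  | RAadd v w => raeval v + raeval w
  | RAopp v => - raeval v
  | RAscale a v => a *: raeval v
  | RAmul v w => raeval v ** raeval w
  end.

Lemma raeval_cong u v : racong u v -> raeval u = raeval v.
Proof.
elim=> //=.
- by move=> ? ? ? _ -> _ ->.
- by move=> ? ? ? ? _ -> _ ->.
- by move=> ? ? _ ->.
- by move=> ? ? ? _ ->.
- by move=> ? ? ? ? _ -> _ ->.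
- by move=> *; rewrite addrA.
- by move=> *; rewrite addrC.
- by move=> *; rewrite add0r.
- by move=> *; rewrite addNr.
- by move=> *; rewrite scalerA.
- by move=> *; rewrite scale1r.
- by move=> *; rewrite scalerDr.
- by move=> *; rewrite scalerDl.
- by move=> a x y z; exact: (ramul_linearl (raeval z)).
- by move=> a x y z; exact: ramul_linearr.
- by move=> *; exact: ramul_rac.
Qed.

Definition ralift (x : freeRA) : A := raeval (repr x).

Lemma ralift_cls u : ralift (racls u) = raeval u.
Proof. by apply: raeval_cong; exact: repr_racls. Qed.

Lemma ralift_gen i : ralift (ragen i) = h i.
Proof. exact: ralift_cls. Qed.

Lemma ralift_linear : linear ralift.
Proof.
move=> a x y; rewrite -(raclsK x) -(raclsK y).
by rewrite -raclsZ -raclsD !ralift_cls.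
Qed.

Lemma ralift_mul x y : ralift (x ** y) = ralift x ** ralift y.
Proof. by rewrite -(raclsK x) -(raclsK y) -raclsM !ralift_cls. Qed.

Lemma ralift_unique (f : freeRA -> A) :
  linear f -> (forall x y, f (x ** y) = f x ** f y) ->
  (forall i, f (ragen i) = h i) -> f =1 ralift.
Proof.
move=> fL fM fg x.
have f0 (g : freeRA -> A) : linear g -> g 0 = 0.
  by move=> gL; have := gL (-1) 0 0; rewrite scaler0 addr0 scaleN1r addNr.
elim/freeRA_ind: x.
- by move=> i; rewrite fg ralift_gen.
- by rewrite !f0 //; exact: ralift_linear.
- by move=> a x y Ex Ey; rewrite fL ralift_linear Ex Ey.
- by move=> x y Ex Ey; rewrite fM ralift_mul Ex Ey.
Qed.

End Lift.
End FreeAlgebra.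

Arguments freeRA : clear implicits.
Arguments ragen F {X} i.

Local Open Scope classical_set_scope.

Definition subspace (F : fieldType) (V : lmodType F) (W : set V) : Prop :=
  W 0 /\ forall (a : F) u v, W u -> W v -> W (a *: u + v).

(* [ramonomial s u]: [u] is a nonassociative monomial whose generators, read
   from left to right, are listed by [s]. *)
Inductive ramonomial (F : fieldType) (X : Type) :
    seq X -> freeRA F X -> Prop :=
| ramonomial_gen i : ramonomial [:: i] (ragen F i)
| ramonomial_mul s t u v :
    ramonomial s u -> ramonomial t v -> ramonomial (s ++ t) (u ** v).

Definition multilinear (F : fieldType) (n : nat) : set (freeRA F 'I_n) :=
  smallest (@subspace F (freeRA F 'I_n))
    [set u | exists2 s, perm_eq s (enum 'I_n) & ramonomial s u].

(* Since [(s * t) i = t (s i)], this is a right action; stability under all of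
   ['S_n] is the same for left and right actions. *)
Definition permvars (F : fieldType) (n : nat) (s : 'S_n) :
    freeRA F 'I_n -> freeRA F 'I_n :=
  ralift (fun i => ragen F (s i)).

Definition Sn_submodule (F : fieldType) (n : nat) (W : set (freeRA F 'I_n)) :
    Prop :=
  [/\ W `<=` @multilinear F n, subspace W &
      forall (s : 'S_n) u, W u -> W (permvars s u)].

Lemma subspace_multilinear (F : fieldType) (n : nat) :
  subspace (@multilinear F n).
Proof.
split=> [W [[W0 _] _] //|a u v mu mv W [[W0 WL] SW]].
have Wu : W u by apply: mu; split.
have Wv : W v by apply: mv; split.
exact: WL.
Qed.

Lemma multilinear_mono (F : fieldType) (n : nat) s (u : freeRA F 'I_n) :
  perm_eq s (enum 'I_n) -> ramonomial s u -> multilinear u.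
Proof. by move=> ps mu W [_]; apply; exists s. Qed.

Lemma permvars_mono (F : fieldType) (n : nat) (p : 'S_n) s u :
  ramonomial s u -> ramonomial (map p s) (@permvars F n p u).
Proof.
elim=> [i|s' t u' v _ IHu _ IHv].
  by rewrite /permvars ralift_gen; exact: ramonomial_gen.
by rewrite map_cat /permvars ralift_mul; exact: ramonomial_mul.
Qed.

Lemma Sn_submodule_multilinear (F : fieldType) (n : nat) :
  Sn_submodule (@multilinear F n).
Proof.
have sm := subspace_multilinear F n.
split=> // p u mu; apply: (mu (fun x => multilinear (permvars p x))); split.
  split=> [|a x y mx my].
    rewrite /permvars -[0](subrr 0) -[- 0]scaleN1r addrC ralift_linear.
    by rewrite scaleN1r addNr; case: sm.
  by rewrite /permvars ralift_linear; case: sm => _; exact.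
move=> x [s ps mx]; apply: (@multilinear_mono _ _ (map p s)).
  have us : uniq (map p s).
    by rewrite (map_inj_uniq perm_inj) (perm_uniq ps) enum_uniq.
  apply: uniq_perm => // [|i]; first exact: enum_uniq.
  rewrite mem_enum -[i](permKV p) (mem_map perm_inj) (perm_mem ps).
  by rewrite mem_enum.
exact: permvars_mono.
Qed.

Definition consequence (F : fieldType) (n : nat) (G : set (freeRA F 'I_n))
    (f : freeRA F 'I_n) : Prop :=
  smallest (@Sn_submodule F n) G f.

Definition equivalent_identities (F : fieldType) (n : nat)
    (f g : freeRA F 'I_n) : Prop :=
  consequence [set g] f /\ consequence [set f] g.

Section Identities.
Variables (F : fieldType) (A : raAlgType F).
Implicit Types x y z t w : A.

Definition diMalcev x y z t : A :=
  ((x ** y) ** z) ** t - ((x ** t) ** y) ** z - (x ** (z ** t)) ** y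
  - (x ** z) ** (y ** t) - x ** ((y ** z) ** t).

Definition Lop x y z : A := (x ** y) ** z - x ** (y ** z) - (x ** z) ** y.

Definition Lidentity x y z : A := Lop y x (z ** x) - Lop y z x ** x.

Definition Lidentity_lin x y z w : A :=
  Lop y x (z ** w) + Lop y w (z ** x) - Lop y z x ** w - Lop y z w ** x.

Lemma ramulDl x y z : (x + y) ** z = x ** z + y ** z.
Proof. by have := ramul_linearl z 1 x y; rewrite /= !scale1r. Qed.

Lemma ramulDr x y z : x ** (y + z) = x ** y + x ** z.
Proof. by have := ramul_linearr x 1 y z; rewrite /= !scale1r. Qed.

Lemma ramulNl x y : (- x) ** y = - (x ** y).
Proof.
by apply/eqP; rewrite -addr_eq0 -ramulDl addNr; apply/eqP;
  have := ramul_linearl y (-1) 0 0; rewrite /= scaler0 addr0 scaleN1r addNr.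
Qed.

Lemma LopD2 x y z t : Lop x (y + z) t = Lop x y t + Lop x z t.
Proof.
by rewrite /Lop !(ramulDl, ramulDr) !opprD [X in X + _]addrACA [LHS]addrACA.
Qed.

Lemma LopD3 x y z t : Lop x y (z + t) = Lop x y z + Lop x y t.
Proof.
by rewrite /Lop !(ramulDl, ramulDr) !opprD [X in X + _]addrACA [LHS]addrACA.
Qed.

(* [Lidentity_lin] is the full polarization of [Lidentity] in [x]. *)
Lemma Lidentity_polar x y z w :
  Lidentity_lin x y z w =
  Lidentity (x + w) y z - Lidentity x y z - Lidentity w y z.
Proof.
pose B a b := Lop y a (z ** b) - Lop y z a ** b.
have BDl a b c : B (a + b) c = B a c + B b c.
  by rewrite /B LopD2 LopD3 ramulDl opprD [LHS]addrACA.
have BDr a b c : B a (b + c) = B a b + B a c.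
  by rewrite /B !ramulDr LopD3 opprD [LHS]addrACA.
have -> : Lidentity_lin x y z w = B x w + B w x.
  by rewrite /Lidentity_lin /B [RHS]addrACA addrA.
rewrite -![Lidentity _ _ _]/(B _ _) BDl !BDr.
have E (a b c d : A) : b + c = (a + b) + (c + d) - a - d.
  by rewrite [a + b]addrC [b + a + _]addrACA -[RHS]addrA -opprD addrK.
exact: E.
Qed.

End Identities.

(* The variables x, y, z, t, respectively x, y, z, w, are the generators
   0, 1, 2, 3. *)
Definition diMalcev_identity (F : fieldType) : freeRA F 'I_4 :=
  diMalcev (ragen F (inord 0)) (ragen F (inord 1)) (ragen F (inord 2))
    (ragen F (inord 3)).

Definition L_identity (F : fieldType) : freeRA F 'I_4 :=
  Lidentity_lin (ragen F (inord 0)) (ragen F (inord 1)) (ragen F (inord 2))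
    (ragen F (inord 3)).

Section IdentitiesMultilinear.
Variable F : fieldType.

Lemma mono4 (i j k l : nat) (u : freeRA F 'I_4) :
  perm_eq [:: i; j; k; l] (iota 0 4) ->
  ramonomial [:: inord i; inord j; inord k; inord l] u -> multilinear u.
Proof.
move=> pijkl; apply: multilinear_mono; apply: (perm_map_inj val_inj).
rewrite val_enum_ord; apply: (perm_trans _ pijkl).
have lt4 m : m \in [:: i; j; k; l] -> (m < 4)%N.
  by rewrite (perm_mem pijkl) mem_iota.
by rewrite /= !inordK ?perm_refl // lt4 // !inE eqxx ?orbT.
Qed.

Lemma multilinearD (u v : freeRA F 'I_4) :
  multilinear u -> multilinear v -> multilinear (u + v).
Proof.
by move=> mu mv; rewrite -[u]scale1r; case: (subspace_multilinear F 4) => _ mL;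
  exact: mL.
Qed.

Lemma multilinearN (u : freeRA F 'I_4) : multilinear u -> multilinear (- u).
Proof.
by move=> mu; case: (subspace_multilinear F 4) => m0 mL;
  rewrite -[- u]addr0 -scaleN1r; exact: mL.
Qed.

Local Ltac split_sum := repeat match goal with
  | |- multilinear (_ + _) => apply: multilinearD
  | |- multilinear (- _) => apply: multilinearN
  end.

Local Ltac rmono := solve
  [ exact: ramonomial_gen
  | apply: (@ramonomial_mul _ _ [:: _] [:: _; _; _]); rmono
  | apply: (@ramonomial_mul _ _ [:: _; _] [:: _; _]); rmono
  | apply: (@ramonomial_mul _ _ [:: _; _; _] [:: _]); rmono
  | apply: (@ramonomial_mul _ _ [:: _] [:: _; _]); rmono
  | apply: (@ramonomial_mul _ _ [:: _; _] [:: _]); rmono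
  | apply: (@ramonomial_mul _ _ [:: _] [:: _]); rmono ].

Local Ltac mono i j k l := apply: (@mono4 i j k l); [by []|rmono].

Local Open Scope nat_scope.

Lemma diMalcev_multilinear : multilinear (diMalcev_identity F).
Proof.
by rewrite /diMalcev_identity /diMalcev; split_sum;
  [mono 0 1 2 3 | mono 0 3 1 2 | mono 0 2 3 1 | mono 0 2 1 3 | mono 0 1 2 3].
Qed.

Lemma L_identity_multilinear : multilinear (L_identity F).
Proof.
rewrite /L_identity /Lidentity_lin /Lop !(ramulDl, ramulNl).
by split_sum;
  [ mono 1 0 2 3 | mono 1 0 2 3 | mono 1 2 3 0
  | mono 1 3 2 0 | mono 1 3 2 0 | mono 1 2 0 3
  | mono 1 2 0 3 | mono 1 2 0 3 | mono 1 0 2 3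
  | mono 1 2 3 0 | mono 1 2 3 0 | mono 1 3 2 0 ].
Qed.

End IdentitiesMultilinear.

(* Main.v *)
From HB Require Import structures.
Require Import Defs.
From mathcomp Require Import all_boot all_order all_algebra.
From mathcomp Require Import perm classical_sets ring.

(** Modulo right anticommutativity, the linearization of [L(y,x,zx) = L(y,z,x)x]
    contains no monomial of type [(a(bc))d], since those occurring in it cancel,
    whereas the di-Malcev identity contains exactly one, [(x(zt))y].  An algebra
    in which all products of four elements vanish except those of type
    [(a(bc))d] therefore satisfies the former identity but not the latter. *)

Set Implicit Arguments.
Unset Strict Implicit.
Unset Printing Implicit Defensive.

Import GRing.Theory.

Section Witness.
Local Open Scope ring_scope.
Variable F : fieldType.

(* The algebra with basis [a, b, p, q, w] and nonzero products of basis elements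
   [ab = -ba = p], [bp = q], [qa = w]. *)
Definition nilRA : Type := (F^o * F^o * F^o * F^o * F^o)%type.
HB.instance Definition _ := GRing.Lmodule.on nilRA.

Definition nilRA_mul (u v : nilRA) : nilRA :=
  let: (a, b, _, q, _) := u in
  let: (a', b', p', _, _) := v in
  (0, 0, a * b' - b * a', b * p', q * a').

Fact nilRA_mul_linearl v : linear (nilRA_mul^~ v).
Proof.
move: v => [[[[a b] p] q] w] k [[[[a1 b1] p1] q1] w1] [[[[a2 b2] p2] q2] w2].
by congr (_, _, _, _, _); rewrite /= /GRing.scale /=; ring.
Qed.

Fact nilRA_mul_linearr u : linear (nilRA_mul u).
Proof.
move: u => [[[[a b] p] q] w] k [[[[a1 b1] p1] q1] w1] [[[[a2 b2] p2] q2] w2].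
by congr (_, _, _, _, _); rewrite /= /GRing.scale /=; ring.
Qed.

(** A left factor [u] sees a product [v ** w] only through its [p]-coordinate, which is
    skew-symmetric in [v] and [w]. *)
Fact nilRA_mul_rac u v w :
  nilRA_mul u (nilRA_mul v w) + nilRA_mul u (nilRA_mul w v) = 0.
Proof.
move: u v w => [[[[a b] p] q] r] [[[[a1 b1] p1] q1] r1] [[[[a2 b2] p2] q2] r2].
by congr (_, _, _, _, _); rewrite /=; ring.
Qed.

HB.instance Definition _ := isRightAnticommutative.Build F nilRA
  nilRA_mul_linearl nilRA_mul_linearr nilRA_mul_rac.

(** The terms [(y(zw))x] and [(y(zx))w] each occur with both signs. *)
Lemma nilRA_Lidentity_lin (x y z w : nilRA) : Lidentity_lin x y z w = 0.
Proof.
move: x y z w => [[[[a b] p] q] r] [[[[a1 b1] p1] q1] r1]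
  [[[[a2 b2] p2] q2] r2] [[[[a3 b3] p3] q3] r3].
by congr (_, _, _, _, _); rewrite /=; ring.
Qed.

(** With [x = t = b] and [y = z = a], the surviving term is [-(b(ab))a = -(bp)a = -qa = -w]. *)
Lemma nilRA_diMalcev :
  @diMalcev F nilRA (0, 1, 0, 0, 0) (1, 0, 0, 0, 0) (1, 0, 0, 0, 0)
    (0, 1, 0, 0, 0) = (0, 0, 0, 0, -1).
Proof. by congr (_, _, _, _, _); rewrite /=; ring. Qed.

End Witness.

Section Identities.
Local Open Scope ring_scope.
Local Open Scope classical_set_scope.
Variables (F : fieldType) (A : raAlgType F).

Section Lift.
Variables (X : Type) (h : X -> A).
Local Notation lift := (ralift h).

Lemma raliftD u v : lift (u + v) = lift u + lift v.
Proof. by rewrite -[u]scale1r ralift_linear !scale1r. Qed.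

Lemma ralift0 : lift 0 = 0.
Proof. by apply: (@addIr _ (lift 0)); rewrite -raliftD !add0r. Qed.

Lemma raliftN u : lift (- u) = - lift u.
Proof. by apply: (@addIr _ (lift u)); rewrite -raliftD !addNr ralift0. Qed.

Lemma ralift_diMalcev x y z t :
  lift (diMalcev x y z t)
  = diMalcev (lift x) (lift y) (lift z) (lift t).
Proof. by rewrite /diMalcev !(raliftD, raliftN, ralift_mul). Qed.

Lemma ralift_Lidentity_lin x y z w :
  lift (Lidentity_lin x y z w)
  = Lidentity_lin (lift x) (lift y) (lift z) (lift w).
Proof. by rewrite /Lidentity_lin /Lop !(raliftD, raliftN, ralift_mul). Qed.

End Lift.

(** Both sides are algebra morphisms in [u] that agree on generators. *)
Lemma ralift_permvars n (h : 'I_n -> A) (s : 'S_n) u :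
  ralift h (permvars s u) = ralift (h \o s) u.
Proof.
apply: (@ralift_unique _ _ _ _ (ralift h \o permvars s)) => [k v w|v w|i].
- by rewrite /permvars /= !ralift_linear.
- by rewrite /permvars /= !ralift_mul.
- by rewrite /permvars /= !ralift_gen.
Qed.

(** The multilinear part of degree [n] of the T-ideal of [A]. *)
Definition identities (n : nat) : set (freeRA F 'I_n) :=
  [set u | multilinear u /\ forall h : 'I_n -> A, ralift h u = 0].

Lemma Sn_submodule_identities n : Sn_submodule (@identities n).
Proof.
have [_ [m0 mL] mS] := Sn_submodule_multilinear F n.
split=> [u []//||s u [mu u0]].
  split=> [|k u v [mu u0] [mv v0]]; first by split=> // h; exact: ralift0.
  by split=> [|h]; [exact: mL | rewrite ralift_linear u0 v0 scaler0 addr0].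
by split=> [|h]; [exact: mS | rewrite ralift_permvars].
Qed.

End Identities.

Theorem theorem4p8 (F : fieldType) (charF : 2%N \notin [pchar F]%R) :
  ~ equivalent_identities (diMalcev_identity F) (L_identity F).
Proof.
move=> [LM _].
(* A consequence lies in every submodule containing its premises, hence holds in any algebra where
   they hold. *)
have [|_] := LM (@identities F (nilRA F) 4).
  split=> [|_ ->]; first exact: Sn_submodule_identities.
  split=> [|h]; first exact: L_identity_multilinear.
  by rewrite ralift_Lidentity_lin; exact: nilRA_Lidentity_lin.
pose a : nilRA F := (1, 0, 0, 0, 0)%R.
pose b : nilRA F := (0, 1, 0, 0, 0)%R.
(* Generators [1] and [2] stand for [y] and [z], while [0] and [3] stand for [x] and [t]. *)
move=> /(_ (fun i => if (i == 1 :> nat) || (i == 2 :> nat) then a else b)).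
rewrite ralift_diMalcev !ralift_gen !inordK //= nilRA_diMalcev.
by case=> /eqP; rewrite oppr_eq0 oner_eq0.
Qed.
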